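(* Let $K:\mathbf{Contr}\to\mathbf{Coll}$ be the forgetful functor from collections-with-contraction to collections and let $H\dashv K$ be its left adjoint (so $H:\mathbf{Coll}\to\mathbf{Contr}$ is the free contraction functor). Then the adjunction $H\dashv K$ decomposes as a chain of adjunctions $$\cdots\ \ \mathbf{Contr}_{k+1}\ \underset{H_{k+1}}{\overset{K_{k+1}}{\rightleftarrows}}\ \mathbf{Contr}_k\ \underset{H_k}{\overset{K_k}{\rightleftarrows}}\ \mathbf{Contr}_{k-1}\ \cdots\ \underset{H_1}{\overset{K_1}{\rightleftarrows}}\ \mathbf{Contr}_0=\mathbf{Coll},\qquad H_k\dashv K_k,$$ where each $K_k$ is the functor forgetting the $k$th dimension of contraction structure. That is, for each $k\ge1$ the functor $K_k$ has a left adjoint $H_k$, such that the following two properties hold for each $k\geq 1$: (i) $H_k$ leaves all dimensions unchanged except the $k$th dimension, and preserves the underlying $(k-1)$-contraction structure; and (ii) for every collection $A$, the underlying $k$-dimensional collection-with-contraction of $HA$ is that of $H_kH_{k-1}\cdots H_1A$.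
   Context: A globular set $A$ consists of sets $A_k$ ($k\ge 0$) of $k$-cells and maps $s,t:A_{k}\to A_{k-1}$ ($k\ge1$) with $ss=st$ and $ts=tt$; morphisms are families of maps commuting with $s$ and $t$. The category is $\mathbf{GSet}$. Let $T$ be the free strict $\omega$-category monad on $\mathbf{GSet}$ and $1$ the terminal globular set (one cell in each dimension). The category $\mathbf{Coll}$ of collections is the slice category $\mathbf{GSet}/T1$. Two $k$-cells $a,b$ of a globular set are parallel if $k=0$, or $k\ge1$ and $sa=sb$, $ta=tb$. A contraction $\gamma$ on a collection $d:A\to T1$ assigns, for every $k\ge0$, to every parallel pair $a,b\in A_k$ and every $(k+1)$-cell $\theta:da\to db$ of $T1$ (i.e. $s\theta=da$, $t\theta=db$), a $(k+1)$-cell $\gamma_\theta(a,b):a\to b$ of $A$ with $d(\gamma_\theta(a,b))=\theta$. A collection-with-contraction is a collection equipped with a specified contraction; a morphism is a morphism $f$ of collections with $f(\gamma_\theta(a,b))=\gamma'_\theta(fa,fb)$ for all such $a,b,\theta$. The category is $\mathbf{Contr}$. It is known that $K:\mathbf{Contr}\to\mathbf{Coll}$ is monadic. The underlying $k$-collection of a collection is obtained by discarding all cells of dimension $>k$. A $k$-contraction $\gamma$ on the underlying $k$-collection of a collection $d:A\to T1$ assigns, for every $m$ with $0\le m\le k-1$, to every parallel pair of $m$-cells $a,b\in A_m$ and every $(m+1)$-cell $\theta:da\to db$ of $T1$, an $(m+1)$-cell $\gamma_\theta(a,b):a\to b$ of $A$ with $d(\gamma_\theta(a,b))=\theta$ (so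 contraction cells have dimension at most $k$, and none are required between $k$-cells). For $k\ge0$, $\mathbf{Contr}_k$ is the category whose objects are (full, not truncated) collections whose underlying $k$-collection is equipped with a $k$-contraction; morphisms are morphisms of collections preserving the $k$-contraction structure. Thus $\mathbf{Contr}_0=\mathbf{Coll}$. The functor $K_k:\mathbf{Contr}_k\to\mathbf{Contr}_{k-1}$ is the identity on underlying collections and forgets the contraction cells of dimension $k$ as structure (that is, forgets the values of $\gamma$ on pairs of $(k-1)$-cells). ''$H_k$ leaves dimension $m$ unchanged'' means that $H_kX$ has the same $m$-cells, over $T1$, as $X$. As left adjoints are determined only up to canonical isomorphism, identifications involving them are understood with suitable choices, or up to canonical isomorphism. *)

(* Defs.v *)
From mathcomp Require Import all_boot.
From Stdlib Require Import FunctionalExtensionality ProofIrrelevance.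

Set Implicit Arguments.
Unset Strict Implicit.
Unset Printing Implicit Defensive.
Set Primitive Projections.

Declare Scope cat_scope.
Delimit Scope cat_scope with cat.
Local Open Scope cat_scope.

Record Category := {
  ob :> Type;
  hom : ob -> ob -> Type;
  idm : forall A, hom A A;
  comp : forall A B C, hom B C -> hom A B -> hom A C;
  comp_idl : forall A B (f : hom A B), comp (idm B) f = f;
  comp_idr : forall A B (f : hom A B), comp f (idm A) = f;
  compA : forall A B C D (h : hom C D) (g : hom B C) (f : hom A B),
    comp h (comp g f) = comp (comp h g) f }.

Arguments hom {_} A B.
Arguments idm {_} A.
Arguments comp {_ A B C} g f.
Notation "g ∘ f" := (comp g f) (at level 40, left associativity) : cat_scope.

Definition is_iso (C : Category) (A B : C) (f : hom A B) : Prop :=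
  exists g : hom B A, g ∘ f = idm A /\ f ∘ g = idm B.

Record Functor (C D : Category) := {
  fobj :> C -> D;
  fmap : forall A B : C, hom A B -> hom (fobj A) (fobj B);
  fmap_id : forall A, fmap (idm A) = idm (fobj A);
  fmap_comp : forall A B E (g : hom B E) (f : hom A B),
    fmap (g ∘ f) = fmap g ∘ fmap f }.

Arguments fmap {C D} F {A B} f : rename.

Lemma Functor_eq C D (F G : Functor C D) (e : fobj F = fobj G) :
  eq_rect _ (fun o => forall A B : C, hom A B -> hom (o A) (o B)) (@fmap _ _ F)
    _ e = @fmap _ _ G -> F = G.
Proof.
case: F G e => [Fo Fm p q] [Go Gm p' q'] /= e; case: Go / e Gm p' q' => Gm p' q'.
move=> /= e; case: Gm / e p' q' => p' q'.
by rewrite (proof_irrelevance _ p p') (proof_irrelevance _ q q').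
Qed.

Definition id_functor (C : Category) : Functor C C :=
  {| fobj := fun A => A; fmap := fun A B f => f;
     fmap_id := fun A => erefl; fmap_comp := fun A B E g f => erefl |}.

Lemma comp_functor_id C D E (G : Functor D E) (F : Functor C D) A :
  fmap G (fmap F (idm A)) = idm (G (F A)).
Proof. by rewrite !fmap_id. Qed.

Lemma comp_functor_comp C D E (G : Functor D E) (F : Functor C D)
    A B B' (g : hom B B') (f : hom A B) :
  fmap G (fmap F (g ∘ f)) = fmap G (fmap F g) ∘ fmap G (fmap F f).
Proof. by rewrite !fmap_comp. Qed.

Definition comp_functor C D E (G : Functor D E) (F : Functor C D) :
    Functor C E :=
  {| fobj := fun A => G (F A); fmap := fun A B f => fmap G (fmap F f);
     fmap_id := comp_functor_id G F; fmap_comp := @comp_functor_comp _ _ _ G F |}.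

Record NatTrans C D (F G : Functor C D) := {
  nt :> forall A, hom (F A) (G A);
  nt_natural : forall A B (f : hom A B), nt B ∘ fmap F f = fmap G f ∘ nt A }.

(* [Adjunction F G] is the data of an adjunction F ⊣ G. *)
Record Adjunction C D (F : Functor C D) (G : Functor D C) := {
  adj_unit : NatTrans (id_functor C) (comp_functor G F);
  adj_counit : NatTrans (comp_functor F G) (id_functor D);
  adj_triangleL : forall A, adj_counit (F A) ∘ fmap F (adj_unit A) = idm (F A);
  adj_triangleR : forall B, fmap G (adj_counit B) ∘ adj_unit (G B) = idm (G B) }.

Record LeftAdjoint C D (G : Functor D C) := {
  ladj :> Functor C D;
  ladj_adj : Adjunction ladj G }.

Definition ladj_unit C D (G : Functor D C) (F : LeftAdjoint G) (A : C) :
    hom A (G (F A)) :=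
  adj_unit (ladj_adj F) A.

Section Slice.
Variables (C : Category) (B : C).

Record slice_ob := { sdom : C; sarr : hom sdom B }.

Record slice_hom (X Y : slice_ob) := {
  smap :> hom (sdom X) (sdom Y);
  smap_comm : sarr Y ∘ smap = sarr X }.

Lemma slice_hom_eq X Y (f g : slice_hom X Y) : smap f = smap g -> f = g.
Proof.
case: f g => [f pf] [g pg] /= e; case: g / e pg => pg.
by rewrite (proof_irrelevance _ pf pg).
Qed.

Definition slice_id X : slice_hom X X :=
  {| smap := idm (sdom X); smap_comm := comp_idr (sarr X) |}.

Lemma slice_comp_comm X Y Z (g : slice_hom Y Z) (f : slice_hom X Y) :
  sarr Z ∘ (smap g ∘ smap f) = sarr X.
Proof. by rewrite compA !smap_comm. Qed.

Definition slice_comp X Y Z (g : slice_hom Y Z) (f : slice_hom X Y) :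
    slice_hom X Z :=
  {| smap := smap g ∘ smap f; smap_comm := slice_comp_comm g f |}.

Definition Slice : Category.
Proof.
refine {| ob := slice_ob; hom := slice_hom; idm := slice_id;
          comp := slice_comp |}.
- by move=> X Y f; apply: slice_hom_eq; rewrite /= comp_idl.
- by move=> X Y f; apply: slice_hom_eq; rewrite /= comp_idr.
- by move=> X Y Z W h g f; apply: slice_hom_eq; rewrite /= compA.
Defined.

End Slice.

Record globular := {
  cell : nat -> Type;
  src : forall k, cell k.+1 -> cell k;
  tgt : forall k, cell k.+1 -> cell k;
  src_src : forall k (x : cell k.+2), src (src x) = src (tgt x);
  tgt_src : forall k (x : cell k.+2), tgt (src x) = tgt (tgt x) }.

Arguments src {_ k} x.
Arguments tgt {_ k} x.

Record globular_hom (A B : globular) := {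
  gmap :> forall k, cell A k -> cell B k;
  gmap_src : forall k (x : cell A k.+1), gmap (src x) = src (gmap x);
  gmap_tgt : forall k (x : cell A k.+1), gmap (tgt x) = tgt (gmap x) }.

Arguments gmap {A B} f {k} x : rename.

Lemma globular_hom_eq A B (f g : globular_hom A B) :
  (forall k (x : cell A k), gmap f x = gmap g x) -> f = g.
Proof.
case: f g => [f sf tf] [g sg tg] /= e.
have efg : f = g.
  by apply: functional_extensionality_dep => k;
     apply: functional_extensionality => x; apply: e.
case: g / efg e sg tg => _ sg tg.
by rewrite (proof_irrelevance _ sf sg) (proof_irrelevance _ tf tg).
Qed.

Definition globular_id A : globular_hom A A :=
  {| gmap := fun k x => x; gmap_src := fun k x => erefl;
     gmap_tgt := fun k x => erefl |}.

Definition globular_comp A B C (g : globular_hom B C) (f : globular_hom A B) :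
  globular_hom A C.
Proof.
refine {| gmap := fun k x => gmap g (gmap f x) |}.
- by move=> k x; rewrite !gmap_src.
- by move=> k x; rewrite !gmap_tgt.
Defined.

Definition GSet : Category.
Proof.
refine {| ob := globular; hom := globular_hom; idm := globular_id;
          comp := globular_comp |}.
- by move=> A B f; apply: globular_hom_eq.
- by move=> A B f; apply: globular_hom_eq.
- by move=> A B C D h g f; apply: globular_hom_eq.
Defined.

Definition terminal_globular : GSet :=
  {| cell := fun _ => unit; src := fun k x => x; tgt := fun k x => x;
     src_src := fun k x => erefl; tgt_src := fun k x => erefl |}.

Definition parallel (A : globular) (k : nat) : cell A k -> cell A k -> Prop :=
  match k with
  | 0 => fun _ _ => True
  | k'.+1 => fun a b => src a = src b /\ tgt a = tgt b
  end.

(* The iterated boundary and identity maps are given by their graphs, so that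
   a composition along p-cells can be indexed by two arbitrary dimensions
   without transporting cells along equations between dimensions. *)
Section Iterated.
Variable A : globular.

(* [iter_src z x]: z is the p-cell s^(n-p) x, where p < n. *)
Inductive iter_src (p : nat) (z : cell A p) : forall n, cell A n -> Prop :=
| iter_src1 (x : cell A p.+1) : src x = z -> iter_src z x
| iter_srcS n (x : cell A n.+1) : iter_src z (src x) -> iter_src z x.

(* [iter_tgt z x]: z is the p-cell t^(n-p) x, where p < n. *)
Inductive iter_tgt (p : nat) (z : cell A p) : forall n, cell A n -> Prop :=
| iter_tgt1 (x : cell A p.+1) : tgt x = z -> iter_tgt z x
| iter_tgtS n (x : cell A n.+1) : iter_tgt z (tgt x) -> iter_tgt z x.

(* [iter_id z x]: x is the n-cell i^(n-p) z, where p < n. *)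
Inductive iter_id (i : forall n, cell A n -> cell A n.+1)
    (p : nat) (z : cell A p) : forall n, cell A n -> Prop :=
| iter_id1 : iter_id i z (i p z)
| iter_idS n (x : cell A n) : iter_id i z x -> iter_id i z (i n x).

(* p < n and s^(n-p) x' = t^(n-p) x *)
Definition composable (p n : nat) (x' x : cell A n) : Prop :=
  exists z : cell A p, iter_src z x' /\ iter_tgt z x.

End Iterated.

(* [ccomp x' x _], with first argument p, is the composite "x' after x" along
   p-cells.  Every proof of composability occurring in an axiom is universally
   quantified; those for the derived composites follow from those for the
   given ones. *)
Record omega_structure (A : globular) := {
  cid : forall n, cell A n -> cell A n.+1;
  ccomp : forall p n (x' x : cell A n), composable p x' x -> cell A n;
  src_cid : forall n (x : cell A n), src (cid x) = x;
  tgt_cid : forall n (x : cell A n), tgt (cid x) = x;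
  src_ccomp1 : forall p (x' x : cell A p.+1) (h : composable p x' x),
    src (ccomp h) = src x;
  tgt_ccomp1 : forall p (x' x : cell A p.+1) (h : composable p x' x),
    tgt (ccomp h) = tgt x';
  src_ccomp : forall p n (x' x : cell A n.+1) (h : composable p x' x)
      (h' : composable p (src x') (src x)),
    src (ccomp h) = ccomp h';
  tgt_ccomp : forall p n (x' x : cell A n.+1) (h : composable p x' x)
      (h' : composable p (tgt x') (tgt x)),
    tgt (ccomp h) = ccomp h';
  ccompA : forall p n (x'' x' x : cell A n)
      (h1 : composable p x'' x') (h2 : composable p (ccomp h1) x)
      (h3 : composable p x' x) (h4 : composable p x'' (ccomp h3)),
    ccomp h2 = ccomp h4;
  ccomp_idl : forall p n (x u : cell A n) (z : cell A p)
      (h : composable p u x),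
    iter_tgt z x -> iter_id cid z u -> ccomp h = x;
  ccomp_idr : forall p n (x u : cell A n) (z : cell A p)
      (h : composable p x u),
    iter_src z x -> iter_id cid z u -> ccomp h = x;
  interchange2 : forall q p n (y' y x' x : cell A n), q < p ->
    forall (hy : composable p y' y) (hx : composable p x' x)
      (h : composable q (ccomp hy) (ccomp hx))
      (h' : composable q y' x') (h0 : composable q y x)
      (k : composable p (ccomp h') (ccomp h0)),
    ccomp h = ccomp k;
  interchange0 : forall p n (x' x : cell A n) (h : composable p x' x)
      (h' : composable p (cid x') (cid x)),
    ccomp h' = cid (ccomp h) }.

Record omega_cat := {
  ocells :> globular;
  ostr : omega_structure ocells }.

Record omega_functor (C D : omega_cat) := {
  omap :> globular_hom C D;
  omap_cid : forall n (x : cell C n),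
    gmap omap (cid (ostr C) x) = cid (ostr D) (gmap omap x);
  omap_ccomp : forall p n (x' x : cell C n) (h : composable p x' x)
      (h' : composable p (gmap omap x') (gmap omap x)),
    gmap omap (ccomp (ostr C) h) = ccomp (ostr D) h' }.

Lemma omega_functor_eq C D (f g : omega_functor C D) : omap f = omap g -> f = g.
Proof.
case: f g => [f p1 p2] [g q1 q2] /= e; case: g / e q1 q2 => q1 q2.
by rewrite (proof_irrelevance _ p1 q1) (proof_irrelevance _ p2 q2).
Qed.

Lemma composable_gmap A B (f : globular_hom A B) p n (x' x : cell A n) :
  composable p x' x -> composable p (gmap f x') (gmap f x).
Proof.
case=> z [hs ht]; exists (gmap f z); split.
- elim: hs => [y <-|m y _ IH].
    by apply: iter_src1; rewrite gmap_src.
  by apply: iter_srcS; rewrite -gmap_src.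
- elim: ht => [y <-|m y _ IH].
    by apply: iter_tgt1; rewrite gmap_tgt.
  by apply: iter_tgtS; rewrite -gmap_tgt.
Qed.

Definition omega_functor_id C : omega_functor C C.
Proof.
refine {| omap := globular_id C |}; first by [].
by move=> p n x' x h h'; rewrite /= (proof_irrelevance _ h h').
Defined.

Definition omega_functor_comp C D E (g : omega_functor D E)
  (f : omega_functor C D) : omega_functor C E.
Proof.
refine {| omap := globular_comp g f |}.
- by move=> n x; rewrite /= !omap_cid.
- move=> p n x' x h h' /=.
  by rewrite (omap_ccomp _ (composable_gmap f h)) omap_ccomp.
Defined.

Definition OmegaCat : Category.
Proof.
refine {| ob := omega_cat; hom := omega_functor; idm := omega_functor_id;
          comp := omega_functor_comp |}.
- by move=> A B f; apply: omega_functor_eq; apply: globular_hom_eq.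
- by move=> A B f; apply: omega_functor_eq; apply: globular_hom_eq.
- by move=> A B C D h g f; apply: omega_functor_eq; apply: globular_hom_eq.
Defined.

Definition OmegaCat_to_GSet : Functor OmegaCat GSet.
Proof.
by refine {| fobj := fun C : OmegaCat => ocells C : GSet;
             fmap := fun C D (f : @hom OmegaCat C D) => omap f |}.
Defined.

(* The functor part of the free strict omega-category monad, for a given choice
   of left adjoint to the forgetful functor. *)
Definition T (Free : LeftAdjoint OmegaCat_to_GSet) : Functor GSet GSet :=
  comp_functor OmegaCat_to_GSet Free.

(* In what follows T1 stands for T applied to the terminal globular set. *)
Section Collections.
Variable T1 : GSet.

Definition Coll : Category := Slice T1.

Definition coll_cell (A : Coll) (k : nat) : Type := cell (sdom A) k.

Definition coll_map (A B : Coll) (f : hom A B) (k : nat) :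
    coll_cell A k -> coll_cell B k :=
  fun x => gmap (smap f) x.

Definition coll_proj (A : Coll) (k : nat) : coll_cell A k -> cell T1 k :=
  fun x => gmap (sarr A) x.

Definition fillable (A : Coll) (k : nat) (a b : coll_cell A k)
    (theta : cell T1 k.+1) : Prop :=
  [/\ parallel a b, src theta = coll_proj a & tgt theta = coll_proj b].

Definition fills (A : Coll) (k : nat) (a b : coll_cell A k)
    (theta : cell T1 k.+1) (c : coll_cell A k.+1) : Prop :=
  [/\ src c = a, tgt c = b & coll_proj c = theta].

Lemma fillable_map A B (f : hom A B) k (a b : coll_cell A k) theta :
  fillable a b theta -> fillable (coll_map f a) (coll_map f b) theta.
Proof.
have pf m (x : coll_cell A m) : coll_proj (coll_map f x) = coll_proj x.
  by rewrite /coll_proj -(smap_comm f).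
rewrite /fillable !pf => -[par hs ht]; split=> //.
case: k a b theta par {hs ht} => [//|k] a b _ /= [es et].
by rewrite /coll_map -!gmap_src -!gmap_tgt es et.
Qed.

Record contraction (A : Coll) := {
  contr : forall k (a b : coll_cell A k) (theta : cell T1 k.+1),
    fillable a b theta -> coll_cell A k.+1;
  contrP : forall k (a b : coll_cell A k) theta (h : fillable a b theta),
    fills a b theta (contr h) }.

Record contr_ob := {
  contr_coll :> Coll;
  contr_str : contraction contr_coll }.

Record contr_hom (X Y : contr_ob) := {
  contr_map :> @hom Coll X Y;
  contr_map_contr : forall k (a b : coll_cell X k) theta (h : fillable a b theta)
      (h' : fillable (coll_map contr_map a) (coll_map contr_map b) theta),
    coll_map contr_map (contr (contr_str X) h) = contr (contr_str Y) h' }.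

Lemma contr_hom_eq X Y (f g : contr_hom X Y) : contr_map f = contr_map g -> f = g.
Proof.
case: f g => [f p] [g q] /= e; case: g / e q => q.
by rewrite (proof_irrelevance _ p q).
Qed.

Definition contr_id X : contr_hom X X.
Proof.
refine {| contr_map := idm (contr_coll X) |} => k a b theta h h'.
by rewrite /coll_map /= (proof_irrelevance _ h h').
Defined.

Definition contr_comp X Y Z (g : contr_hom Y Z) (f : contr_hom X Y) :
  contr_hom X Z.
Proof.
refine {| contr_map := contr_map g ∘ contr_map f |} => k a b theta h h'.
rewrite -[LHS]/(coll_map g (coll_map f (contr (contr_str X) h))).
by rewrite (contr_map_contr _ (fillable_map f h)) contr_map_contr.
Defined.

Definition Contr : Category.
Proof.
refine {| ob := contr_ob; hom := contr_hom; idm := contr_id;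
          comp := contr_comp |}.
- by move=> X Y f; apply: contr_hom_eq; apply: (@comp_idl Coll).
- by move=> X Y f; apply: contr_hom_eq; apply: (@comp_idr Coll).
- by move=> X Y Z W h g f; apply: contr_hom_eq; apply: (@compA Coll).
Defined.

Definition K : Functor Contr Coll.
Proof.
by refine {| fobj := fun X : Contr => contr_coll X;
             fmap := fun X Y (f : @hom Contr X Y) => contr_map f |}.
Defined.

(* The hypothesis [m < k] is the bound 0 <= m <= k - 1. *)
Record kcontraction (k : nat) (A : Coll) := {
  kcontr : forall m (a b : coll_cell A m) (theta : cell T1 m.+1),
    m < k -> fillable a b theta -> coll_cell A m.+1;
  kcontrP : forall m (a b : coll_cell A m) theta (lt_mk : m < k)
      (h : fillable a b theta),
    fills a b theta (kcontr lt_mk h) }.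

Record kcontr_ob (k : nat) := {
  kcontr_coll :> Coll;
  kcontr_str : kcontraction k kcontr_coll }.

Record kcontr_hom (k : nat) (X Y : kcontr_ob k) := {
  kcontr_map :> @hom Coll X Y;
  kcontr_map_contr : forall m (a b : coll_cell X m) theta (lt_mk : m < k)
      (h : fillable a b theta)
      (h' : fillable (coll_map kcontr_map a) (coll_map kcontr_map b) theta),
    coll_map kcontr_map (kcontr (kcontr_str X) lt_mk h)
      = kcontr (kcontr_str Y) lt_mk h' }.

Lemma kcontr_hom_eq k (X Y : kcontr_ob k) (f g : kcontr_hom X Y) :
  kcontr_map f = kcontr_map g -> f = g.
Proof.
case: f g => [f p] [g q] /= e; case: g / e q => q.
by rewrite (proof_irrelevance _ p q).
Qed.

Definition kcontr_id k (X : kcontr_ob k) : kcontr_hom X X.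
Proof.
refine {| kcontr_map := idm (kcontr_coll X) |} => m a b theta lt_mk h h'.
by rewrite /coll_map /= (proof_irrelevance _ h h').
Defined.

Definition kcontr_comp k (X Y Z : kcontr_ob k) (g : kcontr_hom Y Z)
  (f : kcontr_hom X Y) : kcontr_hom X Z.
Proof.
refine {| kcontr_map := kcontr_map g ∘ kcontr_map f |}.
move=> m a b theta lt_mk h h'.
rewrite -[LHS]/(coll_map g (coll_map f (kcontr (kcontr_str X) lt_mk h))).
by rewrite (kcontr_map_contr lt_mk h (fillable_map f h)) kcontr_map_contr.
Defined.

Definition Contr_ (k : nat) : Category.
Proof.
refine {| ob := kcontr_ob k; hom := @kcontr_hom k; idm := @kcontr_id k;
          comp := @kcontr_comp k |}.
- by move=> X Y f; apply: kcontr_hom_eq; apply: (@comp_idl Coll).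
- by move=> X Y f; apply: kcontr_hom_eq; apply: (@comp_idr Coll).
- by move=> X Y Z W h g f; apply: kcontr_hom_eq; apply: (@compA Coll).
Defined.

Definition forget_contr (k : nat) : Functor (Contr_ k) Coll.
Proof.
by refine {| fobj := fun X : Contr_ k => kcontr_coll X;
             fmap := fun X Y (f : @hom (Contr_ k) X Y) => kcontr_map f |}.
Defined.

(* A 0-contraction is an empty family: [Coll_to_Contr_0] and [forget_contr 0]
   are the mutually inverse isomorphisms that identify Contr_0 with Coll. *)
Definition kcontraction0 (A : Coll) : kcontraction 0 A.
Proof.
by refine {| kcontr := fun m a b theta (lt_m0 : m < 0) h =>
               False_rect _ (notF lt_m0) |}.
Defined.

Lemma kcontraction0_unique A (g g' : kcontraction 0 A) : g = g'.
Proof.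
case: g g' => [g gP] [g' gP'].
have e : g = g' by do 5 (apply: functional_extensionality_dep => ?).
by case: g' / e gP' => gP'; rewrite (proof_irrelevance _ gP gP').
Qed.

Definition coll_Contr_0 (A : Coll) : Contr_ 0 :=
  {| kcontr_coll := A; kcontr_str := kcontraction0 A |}.

Definition Coll_to_Contr_0 : Functor Coll (Contr_ 0).
Proof.
unshelve refine {| fobj := coll_Contr_0;
  fmap := fun A B (f : hom A B) =>
    @Build_kcontr_hom 0 (coll_Contr_0 A) (coll_Contr_0 B) f _ |}.
- by [].
- by move=> A; apply: kcontr_hom_eq.
- by move=> A B E g f; apply: kcontr_hom_eq.
Defined.

Lemma Coll_to_Contr_0K :
  comp_functor (forget_contr 0) Coll_to_Contr_0 = id_functor Coll.
Proof. exact: (@Functor_eq _ _ (comp_functor (forget_contr 0) Coll_to_Contr_0)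
  (id_functor Coll) erefl erefl). Qed.

(* [K_ k] is the functor Contr_(k+1) -> Contr_k that forgets the contraction
   cells of dimension k + 1, i.e. the values on pairs of k-cells. *)
Definition kcontraction_pred (k : nat) (A : Coll) (g : kcontraction k.+1 A) :
    kcontraction k A :=
  {| kcontr := fun m a b theta (lt_mk : m < k) h => kcontr g (leqW lt_mk) h;
     kcontrP := fun m a b theta (lt_mk : m < k) h => kcontrP g (leqW lt_mk) h |}.

Definition K_ob (k : nat) (X : Contr_ k.+1) : Contr_ k :=
  {| kcontr_coll := kcontr_coll X;
     kcontr_str := kcontraction_pred (kcontr_str X) |}.

Definition K_ (k : nat) : Functor (Contr_ k.+1) (Contr_ k).
Proof.
unshelve refine {| fobj := @K_ob k;
  fmap := fun X Y (f : hom X Y) =>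
    @Build_kcontr_hom k (K_ob X) (K_ob Y) (kcontr_map f) _ |}.
- by move=> m a b theta lt_mk h h' /=; apply: kcontr_map_contr.
- by move=> X; apply: kcontr_hom_eq.
- by move=> X Y Z g f; apply: kcontr_hom_eq.
Defined.

Definition contraction_upto (k : nat) (A : Coll) (g : contraction A) :
    kcontraction k A :=
  {| kcontr := fun m a b theta _ h => contr g h;
     kcontrP := fun m a b theta _ h => contrP g h |}.

Definition contr_upto_ob (k : nat) (X : Contr) : Contr_ k :=
  {| kcontr_coll := contr_coll X;
     kcontr_str := contraction_upto k (contr_str X) |}.

Definition Contr_upto (k : nat) : Functor Contr (Contr_ k).
Proof.
unshelve refine {| fobj := contr_upto_ob k;
  fmap := fun X Y (f : hom X Y) =>
    @Build_kcontr_hom k (contr_upto_ob k X) (contr_upto_ob k Y)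
      (contr_map f) _ |}.
- by move=> m a b theta lt_mk h h' /=; apply: contr_map_contr.
- by move=> X; apply: kcontr_hom_eq.
- by move=> X Y Z g f; apply: kcontr_hom_eq.
Defined.

Lemma forget_K_ k : comp_functor (forget_contr k) (K_ k) = forget_contr k.+1.
Proof. exact: (@Functor_eq _ _ (comp_functor (forget_contr k) (K_ k))
  (forget_contr k.+1) erefl erefl). Qed.

Lemma forget_Contr_upto k :
  comp_functor (forget_contr k) (Contr_upto k) = K.
Proof. exact: (@Functor_eq _ _
  (comp_functor (forget_contr k) (Contr_upto k)) K erefl erefl). Qed.

(* Discarding the cells of dimension > k.  A k-dimensional collection (with
   k-contraction) is regarded as a collection having no cells of dimension > k,
   so the truncation of an object of Contr_k is again an object of Contr_k. *)
Definition trunc_globular (k : nat) (A : GSet) : GSet.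
Proof.
refine {| cell := fun m => {x : cell A m | m <= k};
          src := fun m x => exist _ (src (sval x)) (ltnW (svalP x));
          tgt := fun m x => exist _ (tgt (sval x)) (ltnW (svalP x)) |}.
- by move=> m x; apply: val_inj; apply: src_src.
- by move=> m x; apply: val_inj; apply: tgt_src.
Defined.

Definition trunc_incl (k : nat) (A : GSet) : hom (trunc_globular k A) A.
Proof. by refine {| gmap := fun m (x : cell (trunc_globular k A) m) => sval x |}. Defined.

Definition trunc_coll (k : nat) (A : Coll) : Coll :=
  {| sdom := trunc_globular k (sdom A);
     sarr := sarr A ∘ trunc_incl k (sdom A) |}.

Lemma trunc_fillable k (A : Coll) m (a b : coll_cell (trunc_coll k A) m) theta :
  fillable a b theta -> @fillable A m (sval a) (sval b) theta.
Proof.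
case=> par hs ht; split=> //; case: m a b theta par {hs ht} => [//|m] a b _.
by case=> /(congr1 sval) /= es /(congr1 sval) /= et.
Qed.

(* The contraction cell of a pair of m-cells has dimension m + 1, and [m < k] is
   by definition [m.+1 <= k]. *)
Definition trunc_kcontraction (k : nat) (A : Coll) (g : kcontraction k A) :
  kcontraction k (trunc_coll k A).
Proof.
unshelve refine {| kcontr := fun m a b theta (lt_mk : m < k) h =>
  exist _ (kcontr g lt_mk (trunc_fillable h)) lt_mk
    : coll_cell (trunc_coll k A) m.+1 |}.
move=> m a b theta lt_mk h.
have [es et ed] := kcontrP g lt_mk (trunc_fillable h).
by split; [apply: val_inj | apply: val_inj | ].
Defined.

Definition trunc_gmap (k : nat) (A B : GSet) (f : hom A B) :
  hom (trunc_globular k A) (trunc_globular k B).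
Proof.
unshelve refine {| gmap := fun m (x : cell (trunc_globular k A) m) =>
  exist _ (gmap f (sval x)) (svalP x) : cell (trunc_globular k B) m |}.
- by move=> m x; apply: val_inj; apply: gmap_src.
- by move=> m x; apply: val_inj; apply: gmap_tgt.
Defined.

Lemma trunc_map_comm k (A B : Coll) (f : hom A B) :
  sarr (trunc_coll k B) ∘ trunc_gmap k (smap f) = sarr (trunc_coll k A).
Proof. by apply: globular_hom_eq => m x; rewrite /= -(smap_comm f). Qed.

Definition trunc_map (k : nat) (A B : Coll) (f : hom A B) :
    hom (trunc_coll k A) (trunc_coll k B) :=
  @Build_slice_hom GSet T1 (trunc_coll k A) (trunc_coll k B)
    (trunc_gmap k (smap f)) (trunc_map_comm k f).

Definition trunc_ob (k : nat) (X : Contr_ k) : Contr_ k :=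
  {| kcontr_coll := trunc_coll k (kcontr_coll X);
     kcontr_str := trunc_kcontraction (kcontr_str X) |}.

Definition trunc (k : nat) : Functor (Contr_ k) (Contr_ k).
Proof.
unshelve refine {| fobj := @trunc_ob k;
  fmap := fun X Y (f : hom X Y) =>
    @Build_kcontr_hom k (trunc_ob X) (trunc_ob Y) (trunc_map k (kcontr_map f)) _ |}.
- move=> m a b theta lt_mk h h'; apply: val_inj => /=.
  exact: kcontr_map_contr.
- move=> X; apply: kcontr_hom_eq; apply: slice_hom_eq.
  by apply: globular_hom_eq => m x; apply: val_inj.
- move=> X Y Z g f; apply: kcontr_hom_eq; apply: slice_hom_eq.
  by apply: globular_hom_eq => m x; apply: val_inj.
Defined.

(* [unchanged_in_dim f m]: f identifies the m-cells of A, over T1, with those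
   of B (any morphism of collections lies over T1). *)
Definition unchanged_in_dim (A B : Coll) (f : hom A B) (m : nat) : Prop :=
  bijective (@coll_map A B f m).

(* [Hs k] is the left adjoint H_(k+1) of [K_ k] = K_(k+1). *)
Section Chain.
Variable Hs : forall k, LeftAdjoint (K_ k).

(* H_k ... H_1 *)
Fixpoint chain_H (k : nat) : Functor Coll (Contr_ k) :=
  match k with
  | 0 => Coll_to_Contr_0
  | k'.+1 => comp_functor (Hs k') (chain_H k')
  end.

(* The unit of the composite adjunction H_k ... H_1 ⊣ K_1 ... K_k, the right
   adjoint being [forget_contr k]. *)
Fixpoint chain_unit (k : nat) (A : Coll) :
    hom A (forget_contr k (chain_H k A)) :=
  match k with
  | 0 => idm A
  | k'.+1 => fmap (forget_contr k') (ladj_unit (Hs k') (chain_H k' A))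
               ∘ chain_unit k' A
  end.

(* phi is the mate H_k ... H_1 A -> HA of the unit A -> KHA of H ⊣ K under the
   composite adjunction, i.e. the canonical comparison. *)
Definition is_comparison (H : LeftAdjoint K) (k : nat) (A : Coll)
    (phi : hom (chain_H k A) (Contr_upto k (H A))) : Prop :=
  fmap (forget_contr k) phi ∘ chain_unit k A = ladj_unit H A.

End Chain.

End Collections.

(* Main.v *)
Require Import Defs.
From mathcomp Require Import all_boot.
From Stdlib Require Import ProofIrrelevance.

(** A contraction can be added one dimension at a time because adjoining
    contraction cells on pairs of [m]-cells creates new cells in dimension
    [m.+1] only, hence disturbs no boundary that is already present in
    dimensions at most [m].

    The construction behind everything is a free one ([free_coll]).  Given a
    collection [A] and a set [P] of dimensions, take formal terms: the cells of
    [A], and a term [fill x y theta] for each pair [x], [y] of terms of the same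
    dimension [n] and each [theta].  A term is kept when every [fill] in it is
    applied to a parallel pair with a matching [theta], in a dimension belonging
    to [P].  The resulting collection has fillers in the dimensions of [P], and
    is universal with that property under [A] ([free_ext], [free_ext_unique]).
    In a dimension that is not the successor of an element of [P] it consists
    of the cells of [A] alone ([free_unitK], [ungenK]).

    If [A] already has a [k]-contraction and [P] contains only dimensions at
    least [k], then in dimensions at most [k] the free collection is [A], so the
    old contraction cells remain available and complete the new fillers to a
    contraction in all dimensions that are below [k] or in [P].  For [P]
    containing [k] alone this is the left adjoint of [K_ k] ([step_ladj]), and
    part (i) is read off from the description of its cells.

    For part (ii), let [P] consist of all dimensions at least [k].  This gives
    a universal arrow ([total_unit]) from any object [W] of [Contr_ k] to a full
    contraction, and the arrow is invertible in dimensions at most [k].  Take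
    [W] to be the value at [A] of the composite of the first [k] free functors.
    Universal arrows compose, so the total free extension of [W] is a free
    contraction on [A], hence is isomorphic to [H A] compatibly with the maps
    from [A].  The comparison from [W] to [H A] is therefore [total_unit]
    followed by an isomorphism, and its [k]-truncation is invertible. *)

Set Implicit Arguments.
Unset Strict Implicit.
Unset Printing Implicit Defensive.

Local Open Scope cat_scope.

(** * Universal arrows *)

Definition universal_arrow (C D : Category) (G : Functor D C) (A : C) (B : D)
    (eta : hom A (G B)) : Prop :=
  forall (B' : D) (f : hom A (G B')),
    exists! g : hom B B', fmap G g ∘ eta = f.

Lemma is_iso_comp (C : Category) (A B E : C) (g : hom B E) (f : hom A B) :
  is_iso g -> is_iso f -> is_iso (g ∘ f).
Proof.
move=> [g' [g'g gg']] [f' [f'f ff']]; exists (f' ∘ g'); split.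
  by rewrite -Defs.compA (Defs.compA g' g f) g'g comp_idl.
by rewrite -Defs.compA (Defs.compA f f' g') ff' comp_idl.
Qed.

Lemma is_iso_fmap (C D : Category) (F : Functor C D) (A B : C) (f : hom A B) :
  is_iso f -> is_iso (fmap F f).
Proof.
by move=> [g [gf fg]]; exists (fmap F g); rewrite -!fmap_comp gf fg !fmap_id.
Qed.

(** The unit of the adjunction built here is [eta] by computation, so that
    [ladj_unit] of a concrete instance reduces to its concrete universal
    arrow. *)
Section LeftAdjointOfUniversal.
Variables (C D : Category) (G : Functor D C).
Variables (F0 : C -> D) (eta : forall A, hom A (G (F0 A))).
Variable ext : forall A B, hom A (G B) -> hom (F0 A) B.
Hypothesis ext_eta : forall A B (f : hom A (G B)), fmap G (ext f) ∘ eta A = f.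
Hypothesis eta_inj : forall A B (g g' : hom (F0 A) B),
  fmap G g ∘ eta A = fmap G g' ∘ eta A -> g = g'.

Definition universal_functor : Functor C D.
Proof.
refine {| fobj := F0; fmap := fun A B (f : hom A B) => ext (eta B ∘ f) |}.
- by move=> A; apply: eta_inj; rewrite ext_eta fmap_id comp_idr comp_idl.
- move=> A B E g f; apply: eta_inj.
  by rewrite ext_eta fmap_comp -Defs.compA ext_eta !Defs.compA ext_eta.
Defined.

Definition universal_unit :
  NatTrans (id_functor C) (comp_functor G universal_functor).
Proof.
by refine {| nt := eta : forall A, hom (id_functor C A)
                                   (comp_functor G universal_functor A) |};
  move=> A B f /=; rewrite ext_eta.
Defined.

Definition universal_counit :
  NatTrans (comp_functor universal_functor G) (id_functor D).
Proof.
refine {| nt := (fun B => ext (idm (G B))) :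
  forall B, hom (comp_functor universal_functor G B) (id_functor D B) |}.
move=> A B f /=; apply: eta_inj.
by rewrite !fmap_comp -!Defs.compA !ext_eta Defs.compA ext_eta comp_idl comp_idr.
Defined.

Definition universal_ladj : LeftAdjoint G.
Proof.
refine {| ladj := universal_functor;
  ladj_adj := {| adj_unit := universal_unit; adj_counit := universal_counit |} |}.
- move=> A /=; apply: eta_inj.
  by rewrite fmap_comp -Defs.compA ext_eta Defs.compA ext_eta comp_idl fmap_id comp_idl.
- by move=> B /=; rewrite ext_eta.
Defined.

End LeftAdjointOfUniversal.

Lemma ladj_unit_universal (C D : Category) (G : Functor D C) (F : LeftAdjoint G)
    (A : C) :
  universal_arrow (ladj_unit F A).
Proof.
rewrite /ladj_unit; case: F => F [eta eps tL tR] /= B f.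
exists (eps B ∘ fmap F f); split.
  have nat_f := nt_natural eta f; rewrite /= in nat_f.
  by rewrite fmap_comp -Defs.compA -nat_f Defs.compA tR comp_idl.
move=> g <-; have nat_g := nt_natural eps g; rewrite /= in nat_g.
by rewrite fmap_comp Defs.compA nat_g -Defs.compA tL comp_idr.
Qed.

Arguments ladj_unit_universal {C D G} F A.

Lemma universal_arrow_comp (C D E : Category) (G : Functor D C)
    (G' : Functor E D) (A : C) (B : D) (X : E)
    (eta : hom A (G B)) (eta' : hom B (G' X)) :
  universal_arrow eta -> universal_arrow eta' ->
  universal_arrow (G := comp_functor G G') (fmap G eta' ∘ eta).
Proof.
move=> uB uX Y f; have [h [hf h_uniq]] := uB _ f.
have [g [gh g_uniq]] := uX _ h; exists g; split.
  by rewrite /= Defs.compA -fmap_comp gh.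
move=> g'; rewrite /= Defs.compA -fmap_comp => /h_uniq h_g'.
by apply: g_uniq; rewrite -h_g'.
Qed.

Lemma universal_arrow_iso (C D : Category) (G : Functor D C) (A : C) (B B' : D)
    (eta : hom A (G B)) (eta' : hom A (G B')) :
  universal_arrow eta -> universal_arrow eta' ->
  exists i : hom B B', fmap G i ∘ eta = eta' /\ is_iso i.
Proof.
move=> uB uB'; have [i [i_eta _]] := uB _ eta'; have [j [j_eta _]] := uB' _ eta.
exists i; split=> //; exists j; split.
  have [g [_ g_uniq]] := uB _ eta.
  rewrite -(g_uniq (idm B)) ?fmap_id ?comp_idl //.
  by symmetry; apply: g_uniq; rewrite fmap_comp -Defs.compA i_eta.
have [g [_ g_uniq]] := uB' _ eta'.
rewrite -(g_uniq (idm B')) ?fmap_id ?comp_idl //.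
by symmetry; apply: g_uniq; rewrite fmap_comp -Defs.compA j_eta.
Qed.

Lemma sval_inj (U : Type) (R : U -> Prop) (u v : {x : U | R x}) :
  sval u = sval v -> u = v.
Proof.
case: u v => [x p] [y q] /= e; case: y / e q => q.
by rewrite (proof_irrelevance _ p q).
Qed.

(** * Fillings in prescribed dimensions *)

Section Fillings.
Variable T1 : GSet.

(** One notion covers contractions ([Q] everything), [k]-contractions
    ([Q] the dimensions below [k]), and the freely adjoined fillers. *)
Record filling (Q : pred nat) (A : Coll T1) := {
  fl : forall m (a b : coll_cell A m) (theta : cell T1 m.+1),
    Q m -> fillable a b theta -> coll_cell A m.+1;
  flP : forall m (a b : coll_cell A m) theta (Qm : Q m) (h : fillable a b theta),
    fills a b theta (fl Qm h) }.

Definition preserves (Q : pred nat) (A B : Coll T1) (gA : filling Q A)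
    (gB : filling Q B) (f : hom A B) : Prop :=
  forall m (a b : coll_cell A m) theta (Qm : Q m) (h : fillable a b theta)
    (h' : fillable (coll_map f a) (coll_map f b) theta),
  coll_map f (fl gA Qm h) = fl gB Qm h'.

Definition kfilling (k : nat) (A : Coll T1) (g : kcontraction k A) :
    filling (fun m => m < k) A :=
  {| fl := fun m a b theta lt_mk h => kcontr g lt_mk h;
     flP := fun m a b theta lt_mk h => kcontrP g lt_mk h |}.

Definition kcontraction_of (k : nat) (A : Coll T1)
    (g : filling (fun m => m < k) A) : kcontraction k A :=
  {| kcontr := fun m a b theta lt_mk h => fl g lt_mk h;
     kcontrP := fun m a b theta lt_mk h => flP g lt_mk h |}.

Definition full_filling (A : Coll T1) (g : contraction A) : filling predT A :=
  {| fl := fun m a b theta _ h => contr g h;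
     flP := fun m a b theta _ h => contrP g h |}.

Definition contraction_of (A : Coll T1) (g : filling predT A) : contraction A :=
  {| contr := fun m a b theta h => fl g (m := m) isT h;
     contrP := fun m a b theta h => flP g (m := m) isT h |}.

Definition restrict_filling (P Q : pred nat) (PQ : forall m, P m -> Q m)
    (A : Coll T1) (g : filling Q A) : filling P A :=
  {| fl := fun m a b theta Pm h => fl g (PQ m Pm) h;
     flP := fun m a b theta Pm h => flP g (PQ m Pm) h |}.

(** Rewriting along equations between cells is blocked by the proof of
    fillability, which this congruence absorbs. *)
Lemma fl_congr (Q : pred nat) (A : Coll T1) (g : filling Q A) m
    (a a' b b' : coll_cell A m) theta (q q' : Q m)
    (h : fillable a b theta) (h' : fillable a' b' theta) :
  a = a' -> b = b' -> fl g q h = fl g q' h'.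
Proof.
move=> ea eb; case: a' / ea h' => h'; case: b' / eb h' => h'.
by rewrite (proof_irrelevance _ h h') (bool_irrelevance q q').
Qed.

Lemma coll_proj_map (A B : Coll T1) (f : hom A B) m (a : coll_cell A m) :
  coll_proj (coll_map f a) = coll_proj a.
Proof. by rewrite /coll_proj -(smap_comm f). Qed.

(** * Freely adjoined fillers *)

Section Free.
Variables (A : Coll T1) (P : pred nat).

(** The fillable pairs of the free collection depend on its boundary maps, so a
    direct inductive definition of its cells would be inductive-recursive.
    Instead the terms are unconstrained, their boundaries are defined by
    matching, and the constraint is imposed afterwards by [wf]. *)
Inductive term : nat -> Type :=
| gen n (a : coll_cell A n) : term n
| fill n (x y : term n) (theta : cell T1 n.+1) : term n.+1.

Definition pre_term (n : nat) : Type :=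
  match n with 0 => unit | n'.+1 => term n' end.

(** Boundary of a generator, with [bd] the source or the target map of [A]; the
    argument has an arbitrary dimension [n], because the boundaries of a term
    are defined by a match that abstracts its dimension. *)
Definition gen_pre (bd : forall n, coll_cell A n.+1 -> coll_cell A n) n :
    coll_cell A n -> pre_term n :=
  match n with 0 => fun _ => tt | n'.+1 => fun a => gen (bd n' a) end.

Definition term_src n (x : term n.+1) : term n :=
  match x in term m return pre_term m with
  | gen m a => gen_pre (@src (sdom A)) a
  | fill m x _ _ => x
  end.

Definition term_tgt n (x : term n.+1) : term n :=
  match x in term m return pre_term m with
  | gen m a => gen_pre (@tgt (sdom A)) a
  | fill m _ y _ => y
  end.

Definition term_proj n (x : term n) : cell T1 n :=
  match x with gen _ a => coll_proj a | fill _ _ _ theta => theta end.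

Definition term_parallel n : term n -> term n -> Prop :=
  match n with
  | 0 => fun _ _ => True
  | n'.+1 => fun x y => term_src x = term_src y /\ term_tgt x = term_tgt y
  end.

Definition term_fillable n (x y : term n) (theta : cell T1 n.+1) : Prop :=
  [/\ term_parallel x y, src theta = term_proj x & tgt theta = term_proj y].

Fixpoint wf n (x : term n) : Prop :=
  match x with
  | gen _ _ => True
  | fill m x y theta => [/\ P m, wf x, wf y & term_fillable x y theta]
  end.

Lemma term_caseS n (R : term n.+1 -> Prop) :
  (forall a : coll_cell A n.+1, R (gen a)) ->
  (forall x y theta, R (fill x y theta)) -> forall x, R x.
Proof.
move=> Rgen Rfill x; move: R Rgen Rfill.
refine (match x as x0 in term m return
  (match m return term m -> Prop with
   | 0 => fun _ => True
   | m'.+1 => fun x0 => forall R : term m'.+1 -> Prop, (forall a, R (gen a)) ->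
       (forall y z theta, R (fill y z theta)) -> R x0
   end x0) with gen m a => _ | fill m y z theta => _ end).
- by case: m a => [//|m] a R Rgen _; apply: Rgen.
- by move=> R _; apply.
Qed.

Lemma wf_src n (x : term n.+1) : wf x -> wf (term_src x).
Proof. by elim/term_caseS: x => [//|x y theta] []. Qed.

Lemma wf_tgt n (x : term n.+1) : wf x -> wf (term_tgt x).
Proof. by elim/term_caseS: x => [//|x y theta] []. Qed.

Lemma term_src_src n (x : term n.+2) :
  wf x -> term_src (term_src x) = term_src (term_tgt x).
Proof.
elim/term_caseS: x => [a _|x y theta [_ _ _ [[]]]] //=.
by rewrite src_src.
Qed.

Lemma term_tgt_src n (x : term n.+2) :
  wf x -> term_tgt (term_src x) = term_tgt (term_tgt x).
Proof.
elim/term_caseS: x => [a _|x y theta [_ _ _ [[]]]] //=.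
by rewrite tgt_src.
Qed.

Lemma term_proj_src n (x : term n.+1) :
  wf x -> term_proj (term_src x) = src (term_proj x).
Proof.
elim/term_caseS: x => [a _|x y theta [_ _ _ []]] //=.
by rewrite /coll_proj gmap_src.
Qed.

Lemma term_proj_tgt n (x : term n.+1) :
  wf x -> term_proj (term_tgt x) = tgt (term_proj x).
Proof.
elim/term_caseS: x => [a _|x y theta [_ _ _ []]] //=.
by rewrite /coll_proj gmap_tgt.
Qed.

Definition free_globular : GSet.
Proof.
refine {| cell := fun n => {x : term n | wf x};
  src := fun n u => exist _ (term_src (sval u)) (wf_src (svalP u));
  tgt := fun n u => exist _ (term_tgt (sval u)) (wf_tgt (svalP u)) |}.
- by move=> n [x wx]; apply: sval_inj; apply: term_src_src.
- by move=> n [x wx]; apply: sval_inj; apply: term_tgt_src.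
Defined.

Definition free_proj : hom free_globular T1.
Proof.
refine {| gmap := fun n (u : cell free_globular n) => term_proj (sval u) |}.
- by move=> n [x wx]; apply: term_proj_src.
- by move=> n [x wx]; apply: term_proj_tgt.
Defined.

Definition free_coll : Coll T1 := {| sdom := free_globular; sarr := free_proj |}.

Lemma free_fillable n (u v : coll_cell free_coll n) theta :
  fillable u v theta -> term_fillable (sval u) (sval v) theta.
Proof.
case=> par hs ht; split=> //; case: n u v theta par {hs ht} => [//|n] u v _.
by case=> /(congr1 sval) /= es /(congr1 sval) /= et.
Qed.

Lemma term_fillable_free n (u v : coll_cell free_coll n) theta :
  term_fillable (sval u) (sval v) theta -> fillable u v theta.
Proof.
case=> par hs ht; split=> //; case: n u v theta par {hs ht} => [//|n] u v _.
by case=> es et; split; apply: sval_inj.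
Qed.

Definition free_filling : filling P free_coll.
Proof.
unshelve refine {| fl := fun m (a b : coll_cell free_coll m) theta Pm h =>
  exist _ (fill (sval a) (sval b) theta)
    (And4 Pm (svalP a) (svalP b) (free_fillable h)) : coll_cell free_coll m.+1 |}.
by move=> m a b theta Pm h; split=> //; apply: sval_inj.
Defined.

Definition free_unit_gmap : @hom GSet (sdom A) free_globular.
Proof.
refine {| gmap := fun n (a : cell (sdom A) n) =>
            exist _ (gen (a : coll_cell A n)) I : cell free_globular n |};
  by move=> n a; apply: sval_inj.
Defined.

Lemma free_unit_comm : free_proj ∘ free_unit_gmap = sarr A.
Proof. exact: globular_hom_eq. Qed.

Definition free_unit : hom A free_coll :=
  @Build_slice_hom GSet T1 A free_coll free_unit_gmap free_unit_comm.

(** In a dimension receiving no fillers, the free collection has only the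
    generators. *)
Definition ungen_term n (x : term n) :
    wf x -> (forall m, n = m.+1 -> ~~ P m) -> coll_cell A n :=
  match x in term n0 return wf x -> (forall m, n0 = m.+1 -> ~~ P m) ->
    coll_cell A n0 with
  | gen _ a => fun _ _ => a
  | fill m x y theta => fun w no =>
      False_rect _ (elimN idP (no m erefl) (let: And4 Pm _ _ _ := w in Pm))
  end.

Definition ungen n (no : forall m, n = m.+1 -> ~~ P m)
    (u : coll_cell free_coll n) : coll_cell A n :=
  ungen_term (svalP u) no.

Lemma free_unitK n (no : forall m, n = m.+1 -> ~~ P m) :
  cancel (@coll_map _ _ _ free_unit n) (ungen no).
Proof. by []. Qed.

Lemma ungenK n (no : forall m, n = m.+1 -> ~~ P m) :
  cancel (ungen no) (@coll_map _ _ _ free_unit n).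
Proof.
case=> x wx; apply: sval_inj; rewrite /ungen /=.
case: x wx no => [//|m x y theta] w no /=; have [Pm _ _ _] := w.
by have /negP /(_ Pm) := no m erefl.
Qed.

Lemma free_unit_inj n : injective (@coll_map _ _ _ free_unit n).
Proof.
move=> a b /(congr1 sval) /= e.
(* The relation holding between generators exactly when the cells are equal,
   which inverts the constructor without an equation between dimensions. *)
pose R (x y : term n) : Prop := match y in term n0 return term n0 -> Prop with
  | gen _ b => fun x =>
     (match x in term n0 return coll_cell A n0 -> Prop with
      | gen _ a => fun b => a = b | _ => fun _ => True end) b
  | _ => fun _ => True end x.
by have: R (gen a) (gen b) by rewrite -e.
Qed.

Lemma free_unit_fillable n (a b : coll_cell A n) theta :
  fillable (coll_map free_unit a) (coll_map free_unit b) theta ->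
  fillable a b theta.
Proof.
case=> par hs ht; split=> //; case: n a b theta par {hs ht} => [//|n] a b _.
rewrite /parallel /coll_map -!gmap_src -!gmap_tgt.
by case=> /free_unit_inj es /free_unit_inj et.
Qed.

Section Extension.
Variables (Y : Coll T1) (gY : filling P Y) (f : hom A Y).

(** The graph of the extension of [f] to terms.  Evaluating [fill x y theta]
    needs the values of [x] and [y] to be parallel, and this involves the values
    of their boundaries, which are not subterms; a relation can be shown
    functional and compatible with boundaries before any value exists. *)
Fixpoint evals n (x : term n) : coll_cell Y n -> Prop :=
  match x in term n return coll_cell Y n -> Prop with
  | gen _ a => fun c => c = coll_map f a
  | fill m x y theta => fun c =>
      exists a b (Pm : P m) (h : fillable a b theta),
        [/\ evals x a, evals y b & c = fl gY Pm h]
  end.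

Lemma evals_inj n (x : term n) c c' : evals x c -> evals x c' -> c = c'.
Proof.
elim: x c c' => [m a|m x IHx y IHy theta] c c' /=; first by move=> -> ->.
move=> [a [b [Pm [h [xa yb ->]]]]] [a' [b' [Pm' [h' [xa' yb' ->]]]]].
by apply: fl_congr; [apply: IHx | apply: IHy].
Qed.

Lemma evals_src n (x : term n.+1) (c : coll_cell Y n.+1) :
  evals x c -> evals (term_src x) (src c).
Proof.
elim/term_caseS: x c => [a|x y theta] c /=.
  by move=> ->; rewrite /coll_map -gmap_src.
by move=> [a [b [Pm [h [xa yb ->]]]]]; have [-> _ _] := flP gY Pm h.
Qed.

Lemma evals_tgt n (x : term n.+1) (c : coll_cell Y n.+1) :
  evals x c -> evals (term_tgt x) (tgt c).
Proof.
elim/term_caseS: x c => [a|x y theta] c /=.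
  by move=> ->; rewrite /coll_map -gmap_tgt.
by move=> [a [b [Pm [h [xa yb ->]]]]]; have [_ -> _] := flP gY Pm h.
Qed.

Lemma evals_proj n (x : term n) c : evals x c -> coll_proj c = term_proj x.
Proof.
case: x c => [m a|m x y theta] c /=; first by move=> ->; apply: coll_proj_map.
by move=> [a [b [Pm [h [xa yb ->]]]]]; have [_ _ ->] := flP gY Pm h.
Qed.

(** Equal boundaries of terms have equal values because the graph is
    functional. *)
Lemma evals_fillable n (x y : term n) theta a b :
  evals x a -> evals y b -> term_fillable x y theta -> fillable a b theta.
Proof.
move=> xa yb [par hs ht]; split; last 2 first.
- by rewrite (evals_proj xa).
- by rewrite (evals_proj yb).
case: n x y theta a b xa yb par {hs ht} => [//|n] x y _ a b xa yb [es et].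
split.
  by apply: evals_inj (evals_src xa) _; rewrite es; apply: evals_src.
by apply: evals_inj (evals_tgt xa) _; rewrite et; apply: evals_tgt.
Qed.

Fixpoint eval n (x : term n) : wf x -> {c | evals x c} :=
  match x in term n return wf x -> {c : coll_cell Y n | evals x c} with
  | gen _ a => fun _ => exist _ (coll_map f a) erefl
  | fill m x y theta => fun w =>
      let Pm := let: And4 Pm _ _ _ := w in Pm in
      let wx := let: And4 _ wx _ _ := w in wx in
      let wy := let: And4 _ _ wy _ := w in wy in
      let fxy := let: And4 _ _ _ fxy := w in fxy in
      let: exist a xa := eval wx in
      let: exist b yb := eval wy in
      let h := evals_fillable xa yb fxy in
      exist _ (fl gY Pm h)
        (ex_intro _ a (ex_intro _ b (ex_intro _ Pm (ex_intro _ h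
          (And3 xa yb erefl)))))
  end.

Definition ext_cell n (u : coll_cell free_coll n) : coll_cell Y n :=
  sval (eval (svalP u)).

Lemma ext_cellP n (u : coll_cell free_coll n) : evals (sval u) (ext_cell u).
Proof. exact: svalP (eval (svalP u)). Qed.

Definition ext_gmap : @hom GSet free_globular (sdom Y).
Proof.
refine {| gmap := fun n (u : cell free_globular n) =>
                    ext_cell (u : coll_cell free_coll n) : cell (sdom Y) n |}.
- move=> n u; apply: evals_inj (ext_cellP (src u : coll_cell free_coll n)) _.
  exact: evals_src (ext_cellP (u : coll_cell free_coll n.+1)).
- move=> n u; apply: evals_inj (ext_cellP (tgt u : coll_cell free_coll n)) _.
  exact: evals_tgt (ext_cellP (u : coll_cell free_coll n.+1)).
Defined.

Lemma ext_comm : sarr Y ∘ ext_gmap = free_proj.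
Proof.
by apply: globular_hom_eq => n u;
   apply: evals_proj (ext_cellP (u : coll_cell free_coll n)).
Qed.

Definition free_ext : hom free_coll Y :=
  @Build_slice_hom GSet T1 free_coll Y ext_gmap ext_comm.

Lemma free_ext_unit : free_ext ∘ free_unit = f.
Proof. exact/slice_hom_eq/globular_hom_eq. Qed.

Lemma free_ext_preserves : preserves free_filling gY free_ext.
Proof.
move=> m u v theta Pm h h'.
apply: (@evals_inj _ (sval (fl free_filling Pm h))); first exact: ext_cellP.
exists (ext_cell u), (ext_cell v), Pm, h'.
by split=> //; apply: ext_cellP.
Qed.

(** Uniqueness of the extension: any filler-preserving map extending [f] computes
    values in the same functional graph. *)
Lemma preserves_evals (g : hom free_coll Y) :
  preserves free_filling gY g -> g ∘ free_unit = f ->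
  forall n (x : term n) (w : wf x),
    evals x (coll_map g (exist _ x w : coll_cell free_coll n)).
Proof.
move=> g_pres g_unit n x; elim: x => [m a w|m x IHx y IHy theta w] /=.
  by rewrite -g_unit /coll_map /=; congr (gmap _ _); apply: sval_inj.
have [Pm wx wy [par hs ht]] := w.
pose u : coll_cell free_coll m := exist _ x wx.
pose v : coll_cell free_coll m := exist _ y wy.
have h : fillable u v theta by apply: term_fillable_free.
exists (coll_map g u), (coll_map g v), Pm, (fillable_map g h).
split; [exact: IHx | exact: IHy |].
by rewrite -(g_pres _ _ _ _ Pm h) /coll_map; congr (gmap _ _); apply: sval_inj.
Qed.

Lemma free_ext_unique (g : hom free_coll Y) :
  preserves free_filling gY g -> g ∘ free_unit = f -> g = free_ext.
Proof.
move=> g_pres g_unit; apply/slice_hom_eq/globular_hom_eq => n [x w].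
apply: evals_inj (preserves_evals g_pres g_unit w) _.
exact: ext_cellP (exist _ x w : coll_cell free_coll n).
Qed.

End Extension.
End Free.

(** * Extending a contraction to higher dimensions *)

Section FreeOver.
Variables (k : nat) (Q : pred nat).
Hypothesis ltk_Q : forall m, m < k -> Q m.

(** Those dimensions of [Q] in which a [k]-contraction does not already supply
    fillers. *)
Definition above : pred nat := fun m => Q m && (k <= m).

Lemma not_above n : n <= k -> forall m, n = m.+1 -> ~~ above m.
Proof. by move=> le_nk m en; rewrite /above leqNgt -en le_nk andbF. Qed.

Lemma aboveP m : Q m -> ~ m < k -> above m.
Proof. by move=> Qm /negP; rewrite /above Qm -leqNgt. Qed.

Lemma above_Q m : above m -> Q m.
Proof. by case/andP. Qed.

Section Object.
Variable X : Contr_ T1 k.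

Definition over_coll : Coll T1 := free_coll (kcontr_coll X) above.
Definition over_unit : hom (kcontr_coll X) over_coll :=
  free_unit (kcontr_coll X) above.

Lemma over_ungen_fillable m (lt_mk : m < k) (u v : coll_cell over_coll m) theta :
  fillable u v theta ->
  fillable (ungen (not_above (ltnW lt_mk)) u) (ungen (not_above (ltnW lt_mk)) v)
    theta.
Proof. by move=> h; apply: (@free_unit_fillable _ above); rewrite !ungenK. Qed.

(** Below [k] both cells of the pair are generators, and the filler is the one
    given by the contraction of [X]; from dimension [k] on it is a formal one. *)
Definition over_fl m (u v : coll_cell over_coll m) theta (Qm : Q m)
    (h : fillable u v theta) : coll_cell over_coll m.+1 :=
  match @idP (m < k) with
  | ReflectT lt_mk =>
      coll_map over_unit (kcontr (kcontr_str X) lt_mk (over_ungen_fillable lt_mk h))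
  | ReflectF ge_mk =>
      fl (free_filling (kcontr_coll X) above) (aboveP Qm ge_mk) h
  end.

Lemma over_flP m (u v : coll_cell over_coll m) theta (Qm : Q m)
    (h : fillable u v theta) : fills u v theta (over_fl Qm h).
Proof.
rewrite /over_fl; case: {-}_ / idP => [lt_mk|ge_mk]; last exact: flP.
have [es et ep] := kcontrP (kcontr_str X) lt_mk (over_ungen_fillable lt_mk h).
split; last by rewrite coll_proj_map.
- by rewrite /coll_map -gmap_src es; apply: ungenK.
- by rewrite /coll_map -gmap_tgt et; apply: ungenK.
Qed.

Definition over_filling : filling Q over_coll :=
  {| fl := over_fl; flP := over_flP |}.

Lemma over_unit_preserves :
  preserves (kfilling (kcontr_str X)) (restrict_filling ltk_Q over_filling)
    over_unit.
Proof.
move=> m a b theta lt_mk h h'; rewrite /= /over_fl.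
case: {-}_ / idP => [lt_mk'|//]; congr (coll_map _ _).
by apply: (fl_congr (kfilling (kcontr_str X))).
Qed.

Section Ext.
Variables (Y : Coll T1) (gY : filling Q Y) (f : hom (kcontr_coll X) Y).

Definition over_ext : hom over_coll Y :=
  free_ext (restrict_filling above_Q gY) f.

Lemma over_ext_unit : over_ext ∘ over_unit = f.
Proof. exact: free_ext_unit. Qed.

(** In dimensions of [above k Q] this is the universal property of the free
    fillers; below [k] the fillers come from [X], and are preserved because [f]
    preserves them. *)
Lemma over_ext_preserves :
  preserves (kfilling (kcontr_str X)) (restrict_filling ltk_Q gY) f ->
  preserves over_filling gY over_ext.
Proof.
move=> f_pres m u v theta Qm h h'; rewrite /= /over_fl.
case: {-}_ / idP => [lt_mk|ge_mk]; last first.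
  have h2 := fillable_map over_ext h.
  rewrite (free_ext_preserves (aboveP Qm ge_mk) h h2).
  exact: (fl_congr gY).
have h3 := over_ungen_fillable lt_mk h.
have := f_pres _ _ _ _ lt_mk h3 (fillable_map f h3).
rewrite -{1}over_ext_unit /= => e.
transitivity (fl gY (ltk_Q lt_mk) (fillable_map f h3)).
  rewrite -e; congr (coll_map over_ext (coll_map over_unit _)).
  exact: (fl_congr (kfilling (kcontr_str X))).
have uE w : coll_map f (ungen (not_above (ltnW lt_mk)) w) = coll_map over_ext w.
  by rewrite -{2}(ungenK (not_above (ltnW lt_mk)) w) -{1}over_ext_unit.
by apply: fl_congr.
Qed.

Lemma over_ext_unique (g : hom over_coll Y) :
  preserves over_filling gY g -> g ∘ over_unit = f -> g = over_ext.
Proof.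
move=> g_pres; apply: free_ext_unique => m u v theta Pm h h' /=.
rewrite -(g_pres _ _ _ _ (above_Q Pm) h h') /= /over_fl.
case: {-}_ / idP => [lt_mk|ge_mk].
  by case/andP: (Pm); rewrite leqNgt lt_mk.
by congr (coll_map g _); apply: (fl_congr (free_filling _ above)).
Qed.

End Ext.
End Object.
End FreeOver.

(** A levelwise inverse of [f] commutes with all the structure automatically,
    since [f] does and is injective.  The inverse is a given family of functions:
    extracting it from bijectivity in each dimension would need choice. *)
Lemma trunc_is_iso (k : nat) (X Y : Contr_ T1 k) (f : hom X Y)
    (g : forall m, m <= k -> coll_cell Y m -> coll_cell X m) :
  (forall m (le_mk : m <= k),
     cancel (@coll_map _ _ _ (kcontr_map f) m) (g m le_mk)) ->
  (forall m (le_mk : m <= k),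
     cancel (g m le_mk) (@coll_map _ _ _ (kcontr_map f) m)) ->
  is_iso (fmap (trunc T1 k) f).
Proof.
move=> fK gK.
have f_inj m (le_mk : m <= k) : injective (@coll_map _ _ _ (kcontr_map f) m).
  exact: can_inj (fK m le_mk).
pose gt m (y : cell (sdom (trunc_coll k (kcontr_coll Y))) m)
    : cell (sdom (trunc_coll k (kcontr_coll X))) m :=
  exist _ (g m (svalP y) (sval y)) (svalP y).
have gt_src m y : gt m (src y) = src (gt m.+1 y).
  apply: val_inj; apply: (f_inj m (ltnW (svalP y))); rewrite gK.
  by rewrite /coll_map gmap_src; congr src; rewrite -[LHS](gK _ (svalP y)).
have gt_tgt m y : gt m (tgt y) = tgt (gt m.+1 y).
  apply: val_inj; apply: (f_inj m (ltnW (svalP y))); rewrite gK.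
  by rewrite /coll_map gmap_tgt; congr tgt; rewrite -[LHS](gK _ (svalP y)).
pose gg : @hom GSet (sdom (trunc_coll k (kcontr_coll Y)))
                    (sdom (trunc_coll k (kcontr_coll X))) :=
  {| gmap := gt; gmap_src := gt_src; gmap_tgt := gt_tgt |}.
have gg_comm : sarr (trunc_coll k (kcontr_coll X)) ∘ gg
             = sarr (trunc_coll k (kcontr_coll Y)).
  apply: globular_hom_eq => m y; rewrite /= -(smap_comm (kcontr_map f)) /=.
  by congr (gmap _ _); apply: gK.
pose gs : @hom (Coll T1) (trunc_coll k (kcontr_coll Y))
                         (trunc_coll k (kcontr_coll X)) :=
  @Build_slice_hom GSet T1 _ _ gg gg_comm.
have gs_contr m (a b : coll_cell (trunc_coll k (kcontr_coll Y)) m) theta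
    (lt_mk : m < k) (h : fillable a b theta)
    (h' : fillable (coll_map gs a) (coll_map gs b) theta) :
  coll_map gs (kcontr (kcontr_str (trunc_ob Y)) lt_mk h)
    = kcontr (kcontr_str (trunc_ob X)) lt_mk h'.
  apply: val_inj; apply: (f_inj _ lt_mk); rewrite gK /=.
  have h2 := fillable_map (kcontr_map f) (trunc_fillable h').
  rewrite (kcontr_map_contr lt_mk (trunc_fillable h') h2).
  by apply: (fl_congr (kfilling (kcontr_str Y))); rewrite /= gK.
exists (@Build_kcontr_hom T1 k (trunc_ob Y) (trunc_ob X) gs gs_contr).
by split; apply/kcontr_hom_eq/slice_hom_eq/globular_hom_eq => m x;
   apply: val_inj; [apply: fK | apply: gK].
Qed.

(** * One-step and total free extensions *)

Section FreeStep.
Variable k : nat.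

Definition step_ob (X : Contr_ T1 k) : Contr_ T1 k.+1 :=
  {| kcontr_coll := over_coll (fun m => m < k.+1) X;
     kcontr_str := kcontraction_of (over_filling (fun m => m < k.+1) X) |}.

Lemma step_unit_contr (X : Contr_ T1 k) m (a b : coll_cell X m) theta
    (lt_mk : m < k) (h : fillable a b theta)
    (h' : fillable (coll_map (over_unit (fun m => m < k.+1) X) a)
                   (coll_map (over_unit (fun m => m < k.+1) X) b) theta) :
  coll_map (over_unit (fun m => m < k.+1) X) (kcontr (kcontr_str X) lt_mk h)
    = kcontr (kcontr_str (K_ T1 k (step_ob X))) lt_mk h'.
Proof. exact: (over_unit_preserves (fun m lt_mk => leqW lt_mk)). Qed.

Definition step_unit (X : Contr_ T1 k) : hom X (K_ T1 k (step_ob X)) :=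
  @Build_kcontr_hom T1 k X (K_ T1 k (step_ob X))
    (over_unit (fun m => m < k.+1) X) (@step_unit_contr X).

Definition step_ext (X : Contr_ T1 k) (Y : Contr_ T1 k.+1)
  (f : hom X (K_ T1 k Y)) : hom (step_ob X) Y.
Proof.
refine (@Build_kcontr_hom T1 k.+1 (step_ob X) Y
  (over_ext (kfilling (kcontr_str Y)) (kcontr_map f)) _).
apply: (@over_ext_preserves k (fun m => m < k.+1) (fun m lt_mk => leqW lt_mk)).
move=> m a b theta lt_mk h h'; exact: (kcontr_map_contr lt_mk h h').
Defined.

Lemma step_ext_unit X Y (f : hom X (K_ T1 k Y)) :
  fmap (K_ T1 k) (step_ext f) ∘ step_unit X = f.
Proof. by apply: kcontr_hom_eq; apply: over_ext_unit. Qed.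

Lemma step_unit_inj X (Y : Contr_ T1 k.+1) (g g' : hom (step_ob X) Y) :
  fmap (K_ T1 k) g ∘ step_unit X = fmap (K_ T1 k) g' ∘ step_unit X -> g = g'.
Proof.
move=> /(congr1 (@kcontr_map _ _ _ _)) e; apply: kcontr_hom_eq.
have pres (h : hom (step_ob X) Y) : preserves (over_filling (fun m => m < k.+1) X)
    (kfilling (kcontr_str Y)) (kcontr_map h).
  by move=> m a b theta lt_mk p p'; exact: (@kcontr_map_contr _ _ _ _ h _ _ _ _ lt_mk p p').
by rewrite (over_ext_unique (pres g) e) (over_ext_unique (pres g') erefl).
Qed.

Definition step_ladj : LeftAdjoint (K_ T1 k) :=
  universal_ladj step_ext_unit step_unit_inj.

(** Extension of a [k]-contraction to a full contraction, all the fillers from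
    dimension [k] on being adjoined at once. *)
Definition total_ob (X : Contr_ T1 k) : Contr T1 :=
  {| contr_coll := over_coll predT X;
     contr_str := contraction_of (over_filling predT X) |}.

Lemma total_unit_contr (X : Contr_ T1 k) m (a b : coll_cell X m) theta
    (lt_mk : m < k) (h : fillable a b theta)
    (h' : fillable (coll_map (over_unit predT X) a)
                   (coll_map (over_unit predT X) b) theta) :
  coll_map (over_unit predT X) (kcontr (kcontr_str X) lt_mk h)
    = kcontr (kcontr_str (Contr_upto T1 k (total_ob X))) lt_mk h'.
Proof. exact: (over_unit_preserves (Q := predT) (fun m _ => isT)). Qed.

Definition total_unit (X : Contr_ T1 k) :
    hom X (Contr_upto T1 k (total_ob X)) :=
  @Build_kcontr_hom T1 k X (Contr_upto T1 k (total_ob X))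
    (over_unit predT X) (@total_unit_contr X).

Lemma total_unit_universal X : universal_arrow (total_unit X).
Proof.
move=> Y f.
have f_pres : preserves (kfilling (kcontr_str X))
    (restrict_filling (fun m (_ : m < k) => isT) (full_filling (contr_str Y)))
    (kcontr_map f).
  by move=> m a b theta lt_mk h h'; apply: (kcontr_map_contr lt_mk h h').
have ext_pres := over_ext_preserves f_pres.
exists (@Build_contr_hom T1 (total_ob X) Y
  (over_ext (full_filling (contr_str Y)) (kcontr_map f))
  (fun m a b theta h h' => ext_pres m a b theta isT h h')).
split; first by apply: kcontr_hom_eq; apply: over_ext_unit.
move=> g /(congr1 (@kcontr_map _ _ _ _)) e; apply: contr_hom_eq.
symmetry; apply: (over_ext_unique _ e) => m a b theta Qm h h'.
by rewrite (bool_irrelevance Qm isT); apply: contr_map_contr.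
Qed.

(** Formal fillers have dimension [j.+1] with [k <= j < k.+1]. *)
Lemma step_unit_unchanged X m :
  m <> k.+1 ->
  unchanged_in_dim (fmap (forget_contr T1 k) (ladj_unit step_ladj X)) m.
Proof.
move=> m_neq; have no j : m = j.+1 -> ~~ above k (fun m => m < k.+1) j.
  move=> mj; apply/negP => /andP[lt_jk le_kj]; apply: m_neq; rewrite mj.
  by congr _.+1; apply/eqP; rewrite eqn_leq le_kj andbT -ltnS.
by exists (ungen no); [apply: free_unitK | apply: ungenK].
Qed.

Lemma step_unit_trunc_iso X : is_iso (fmap (trunc T1 k) (ladj_unit step_ladj X)).
Proof.
apply: (trunc_is_iso (X := X) (Y := K_ T1 k (step_ob X)) (f := step_unit X)
  (g := fun m le_mk => ungen (not_above (fun m => m < k.+1) le_mk))).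
- by move=> m le_mk; apply: free_unitK.
- by move=> m le_mk; apply: ungenK.
Qed.

Lemma total_unit_trunc_iso X : is_iso (fmap (trunc T1 k) (total_unit X)).
Proof.
apply: (trunc_is_iso (f := total_unit X)
  (g := fun m le_mk => ungen (not_above predT le_mk))).
- by move=> m le_mk; apply: free_unitK.
- by move=> m le_mk; apply: ungenK.
Qed.

End FreeStep.

Arguments total_unit_universal {k} X.

(** * The chain of free functors *)

Section ChainUniversal.
Variable Hs : forall k, LeftAdjoint (K_ T1 k).

Lemma chain_unit_universal k (A : Coll T1) :
  universal_arrow (G := forget_contr T1 k) (chain_unit Hs k A).
Proof.
elim: k => [|k IHk].
  move=> Y f.
  have f_contr m (a b : coll_cell A m) theta (lt_m0 : m < 0)
      (h : fillable a b theta)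
      (h' : fillable (coll_map f a) (coll_map f b) theta) :
    coll_map f (kcontr (kcontr_str (coll_Contr_0 A)) lt_m0 h)
      = kcontr (kcontr_str Y) lt_m0 h' by [].
  exists (@Build_kcontr_hom T1 0 (coll_Contr_0 A) Y f f_contr).
  split; first exact: (@comp_idr (Coll T1)).
  by move=> g g_f; apply: kcontr_hom_eq; rewrite -[LHS]g_f; apply: (@comp_idr (Coll T1)).
exact (universal_arrow_comp IHk
  (ladj_unit_universal (Hs k) (chain_H Hs k A))).
Qed.

Arguments chain_unit_universal k A : clear implicits.

(** [H A] and the total free extension of [chain_H Hs k A] are both free
    contractions on [A], and the second restricts in dimensions at most [k] to
    [chain_H Hs k A]. *)
Lemma comparison_trunc_iso (H : LeftAdjoint (K T1)) k (A : Coll T1) :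
  exists phi : hom (chain_H Hs k A) (Contr_upto T1 k (H A)),
    is_comparison phi /\ is_iso (fmap (trunc T1 k) phi).
Proof.
have u_total := universal_arrow_comp (chain_unit_universal k A)
  (total_unit_universal (chain_H Hs k A)).
(* [K] is, by computation, [forget_contr k] after [Contr_upto k]. *)
have u_H : universal_arrow (G := comp_functor (forget_contr T1 k)
    (Contr_upto T1 k)) (ladj_unit H A).
  exact: (ladj_unit_universal H A).
have [i [i_unit i_iso]] := universal_arrow_iso u_total u_H.
exists (fmap (Contr_upto T1 k) i ∘ total_unit (chain_H Hs k A)); split.
  by rewrite /is_comparison fmap_comp -Defs.compA.
rewrite fmap_comp; apply: is_iso_comp; last exact: total_unit_trunc_iso.
by do 2 apply: is_iso_fmap.
Qed.

End ChainUniversal.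
End Fillings.

Unset Implicit Arguments.

Theorem proposition2p2 (Free : LeftAdjoint OmegaCat_to_GSet)
    (H : LeftAdjoint (K (T Free terminal_globular))) :
  exists Hs : forall k : nat, LeftAdjoint (K_ (T Free terminal_globular) k),
    (* (i), for H_(k+1) *)
    (forall (k : nat) (X : Contr_ (T Free terminal_globular) k),
       (forall m : nat, m <> k.+1 ->
          unchanged_in_dim
            (fmap (forget_contr (T Free terminal_globular) k)
               (ladj_unit (Hs k) X)) m) /\
       is_iso (fmap (trunc (T Free terminal_globular) k)
                 (ladj_unit (Hs k) X))) /\
    (* (ii), in dimension k + 1 *)
    (forall (k : nat) (A : Coll (T Free terminal_globular)),
       exists phi : hom (chain_H Hs k.+1 A)
                        (Contr_upto (T Free terminal_globular) k.+1 (H A)),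
         is_comparison phi /\
         is_iso (fmap (trunc (T Free terminal_globular) k.+1) phi)).
Proof.
exists (@step_ladj (T Free terminal_globular)); split=> [k X|k A].
  split=> [m m_neq|]; first exact: step_unit_unchanged.
  exact: step_unit_trunc_iso.
exact: comparison_trunc_iso.
Qed.
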